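(* Let $d \ge 1$ and consider the standard continuous-time frog model on $\mathbb{Z}^d$ with initial particle distribution $\mu$. There exists a probability distribution $\mu$ on $\mathbb{N}\cup\{0\}$ such that the time $$\tau := \inf\{t \ge 0 : \text{there are infinitely many active particles at time } t\}$$ is almost surely finite.
   Context: Standard continuous-time frog model on $\mathbb{Z}^d$ with initial distribution $\mu$ (a probability distribution on $\mathbb{N}\cup\{0\}$): at time $t=0$ there are $\eta(x)$ particles at each $x\in\mathbb{Z}^d$, where $\{\eta(x)\}_{x\in\mathbb{Z}^d}$ are i.i.d. with distribution $\mu$. The particles at the origin are active at time $0$; all other particles are dormant. If $\eta(\mathbf{0})=0$, one active particle is added at the origin, so that there is always at least one active particle at the origin at time $0$. Active particles perform simple continuous-time random walks (waiting times between successive jumps are independent unit exponential random variables, and each jump is to a uniformly chosen nearest neighbour in $\mathbb{Z}^d$, independently of everything else), independently of all other particles and of $\eta$. Dormant particles stay put until the first arrival of an active particle at their site; upon arrival they become active and start their own simple random walks. Formally: let $(S^{(x,j)}_t)_{t\ge 0}$, $x\in\mathbb{Z}^d$, $j\in\mathbb{N}$, be independent such walks with $S^{(x,j)}_0=\mathbf{0}$, independent of $\eta$; the walk $(x,j)$ is used only if $j\le\eta(x)$ (for $x=\mathbf{0}$, if $j\le\max(\eta(\mathbf{0}),1)$), and the $j$-th particle started at $x$ is at position $x+S^{(x,j)}_s$ at time $s$ after its activation. A site $x$ has been visited by an active particle by time $t$ if and only if there is a finite chain of sites $\mathbf{0}=x_0,x_1,\dots,x_k=x$ and used indices $(x_i,j_i)$,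 $0\le i<k$, such that the sum over $i$ of the first times at which $x_i+S^{(x_i,j_i)}$ hits $x_{i+1}$ is at most $t$. The particles active at time $t$ are exactly the particles whose starting site has been visited by time $t$. By convention $\inf\varnothing=\infty$. *)

(* Defs.v *)
From HB Require Import structures.
From mathcomp Require Import all_boot all_order all_algebra.
From mathcomp Require Import all_classical all_reals all_analysis.

Set Implicit Arguments.
Unset Strict Implicit.
Unset Printing Implicit Defensive.

Import Order.TTheory GRing.Theory Num.Theory.

Local Open Scope classical_set_scope.
Local Open Scope ring_scope.

Notation site d := 'rV[int]_d (only parsing).

Definition l1norm (d : nat) (x : site d) : nat := (\sum_(i < d) `|x 0%R i|)%N.

Definition jump_time (R : realType) (wait : nat -> R) (n : nat) : R :=
  \sum_(k < n) wait k.

(* Jump number n happens at time [jump_time wait n.+1].  The sum over the jumps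
   made by time s is 0 by convention if infinitely many nonzero jumps are made
   by time s, which has probability zero in the model below. *)
Definition walk (R : realType) (d : nat) (wait : nat -> R)
    (step : nat -> site d) (s : R) : site d :=
  \sum_(n \in [set n | jump_time wait n.+1 <= s]) step n.

Definition hitting_time (R : realType) (d : nat) (wait : nat -> R)
    (step : nat -> site d) (x y : site d) : \bar R :=
  ereal_inf [set s%:E | s in
    [set s : R | 0 <= s /\ x + walk wait step s = y]].

(* The particles initially at x are numbered from 0, so that particle (x, j)
   exists iff j < eta x; the origin always carries at least one particle. *)
Definition used (d : nat) (eta : site d -> nat) (x : site d) (j : nat) : bool :=
  (j < if x == 0%R then maxn (eta x) 1 else eta x)%N.

Definition visited (R : realType) (d : nat) (eta : site d -> nat)
    (wait : site d -> nat -> nat -> R) (step : site d -> nat -> nat -> site d)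
    (t : R) (x : site d) : Prop :=
  exists (k : nat) (y : nat -> site d) (j : nat -> nat),
    [/\ y 0%N = 0, y k = x,
        forall i, (i < k)%N -> used eta (y i) (j i) &
        (\sum_(i < k) hitting_time (wait (y i) (j i)) (step (y i) (j i))
                                   (y i) (y i.+1) <= t%:E)%E].

Definition active (R : realType) (d : nat) (eta : site d -> nat)
    (wait : site d -> nat -> nat -> R) (step : site d -> nat -> nat -> site d)
    (t : R) : set (site d * nat)%type :=
  [set p | used eta p.1 p.2 /\ visited eta wait step t p.1].

Definition explosion_time (R : realType) (d : nat) (eta : site d -> nat)
    (wait : site d -> nat -> nat -> R) (step : site d -> nat -> nat -> site d)
    : \bar R :=
  ereal_inf [set t%:E | t in
    [set t : R | 0 <= t /\ infinite_set (active eta wait step t)]].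

Definition mutually_independent (disp : measure_display)
    (T : measurableType disp) (R : realType) (P : probability T R)
    (I : eqType) (F : I -> set (set T)) : Prop :=
  forall (J : seq I) (A : I -> set T), uniq J ->
    (forall i, i \in J -> F i (A i)) ->
    P (\bigcap_(i in [set` J]) A i) = (\prod_(i <- J) fine (P (A i)))%:E.

(* The sigma-algebras generated by the variables of the model; the index
   distinguishes eta x, wait x j n and step x j n. *)
Definition frog_sigma_algebra (disp : measure_display)
    (T : measurableType disp) (R : realType) (P : probability T R) (d : nat)
    (eta : site d -> {RV P >-> nat})
    (wait : site d -> nat -> nat -> {RV P >-> measurableTypeR R})
    (step : site d -> nat -> nat -> T -> site d)
    (i : (site d + (site d * nat * nat) + (site d * nat * nat))%type)
    : set (set T) :=
  match i with
  | inl (inl x) => preimage_set_system setT (eta x) measurable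
  | inl (inr (x, j, n)) => preimage_set_system setT (wait x j n) measurable
  | inr (x, j, n) => preimage_set_system setT (step x j n) setT
  end.

Record frog_model (disp : measure_display) (T : measurableType disp)
    (R : realType) (P : probability T R) (d : nat) (mu : probability nat R)
    (eta : site d -> {RV P >-> nat})
    (wait : site d -> nat -> nat -> {RV P >-> measurableTypeR R})
    (step : site d -> nat -> nat -> T -> site d) : Prop := FrogModel {
  frog_eta : forall x A, distribution P (eta x) A = mu A;
  frog_wait : forall x j n (A : set (measurableTypeR R)), measurable A ->
    distribution P (wait x j n) A = exponential_prob 1 A;
  frog_step_measurable : forall x j n v, measurable (step x j n @^-1` [set v]);
  frog_step : forall x j n v, l1norm v = 1%N ->
    P (step x j n @^-1` [set v]) = ((2 * d)%:R^-1)%:E;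
  frog_independent :
    mutually_independent P (frog_sigma_algebra eta wait step) }.

(* Main.v *)
(* The law mu charges each value (M n).+1 with a Poisson weight q_n > 0. On a
   half-line y + N e1, choose the width of the n-th block so large that, up to
   probability 2^-n / 4, the block has a site with more than M n particles; this
   depends on q_n only, so M n can be chosen afterwards, so large that, up to
   probability 2^-n / 4, from every site of block n one of the particles
   1, ..., M n runs straight through block n + 1 within time 2^-n. If both hold
   for all n >= K and block K is visited, then infinitely many sites are visited
   within two further time units. Block K is reached by particle 0 of the origin:
   its walk almost surely contains a run of steps e1 as long as the blocks
   0, ..., K together, and y is the start of the first such run. Particle 0 is not
   used in the later crossings, so the failures, of total probability O(2^-K), are
   independent of the path leading to y. Finally K is arbitrary. *)
Require Import Defs.
From mathcomp Require Import all_boot all_order all_algebra.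
From mathcomp Require Import all_classical all_reals all_analysis.
From mathcomp Require Import lra.

Local Open Scope classical_set_scope.
Local Open Scope ring_scope.

Set Implicit Arguments.
Unset Strict Implicit.
Unset Printing Implicit Defensive.

Import Order.TTheory GRing.Theory Num.Theory.

Lemma uniq_flatten_tagged (I J : eqType) (g : I -> J) (f : J -> seq I)
    (s : seq J) :
  uniq s -> (forall j, uniq (f j)) -> (forall j i, i \in f j -> g i = j) ->
  uniq (flatten (map f s)).
Proof.
move=> + fu fg; elim: s => //= j s IH /andP[js us].
rewrite cat_uniq fu IH // andbT; apply/hasPn => i /flattenP[_ /mapP[k ks ->]].
by move=> /fg ik; apply: contra js => /fg; rewrite ik => <-.
Qed.

Section Independence.
Context d (T : measurableType d) (R : realType) (P : probability T R).
Context (I : eqType) (F : I -> set (set T)) (A : I -> set T).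
Hypothesis indF : mutually_independent P F.
Hypothesis FA : forall i, F i (A i).
Hypothesis mA : forall i, measurable (A i).

Definition cyl (J : seq I) : set T := \bigcap_(i in [set` J]) A i.

Lemma measurable_cyl J : measurable (cyl J).
Proof. by apply: fin_bigcap_measurable => // i _; exact: mA. Qed.

Lemma cyl_cat J L : cyl (J ++ L) = cyl J `&` cyl L.
Proof.
apply/seteqP; split => [w wJL|w [wJ wL] i /=].
  by split => i iJ; apply: wJL => /=; rewrite mem_cat; apply/orP; [left|right].
by rewrite mem_cat => /orP[]; [exact: wJ|exact: wL].
Qed.

Lemma prob_cyl J : uniq J -> P (cyl J) = (\prod_(i <- J) fine (P (A i)))%:E.
Proof. by move=> uJ; apply: indF. Qed.

Definition cyl_fail (Ls : seq (seq I)) : set T :=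
  \bigcap_(L in [set` Ls]) ~` cyl L.

Lemma measurable_cyl_fail Ls : measurable (cyl_fail Ls).
Proof.
by apply: fin_bigcap_measurable => // L _; apply/measurableC/measurable_cyl.
Qed.

Lemma cyl_fail_cons L Ls : cyl_fail (L :: Ls) = ~` cyl L `&` cyl_fail Ls.
Proof.
apply/seteqP; split => [w wL|w [wL wLs] M /=].
  split; first by apply: wL => /=; rewrite mem_head.
  by move=> M MLs; apply: wL => /=; rewrite inE [_ \in _]MLs orbT.
by rewrite inE => /orP[/eqP ->|/wLs].
Qed.

(* Inclusion-exclusion over one failing cylinder at a time; [J] is general
   because the induction moves [L] into it. *)
Lemma prob_cyl_fail J Ls : uniq (J ++ flatten Ls) ->
  P (cyl J `&` cyl_fail Ls) =
  (fine (P (cyl J)) * \prod_(L <- Ls) (1 - fine (P (cyl L))))%:E.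
Proof.
elim: Ls J => [|L Ls IH] J /=.
  rewrite cats0 => uJ; rewrite /cyl_fail big_nil mulr1.
  have -> : \bigcap_(L in [set` [::]]) ~` cyl L = setT by apply/seteqP; split.
  by rewrite setIT prob_cyl.
rewrite catA => uJLs; rewrite cyl_fail_cons.
have -> : cyl J `&` (~` cyl L `&` cyl_fail Ls) =
    (cyl J `&` cyl_fail Ls) `\` (cyl (J ++ L) `&` cyl_fail Ls).
  rewrite cyl_cat; apply/seteqP; split => w /=.
    by move=> [wJ [wL wLs]]; split => // -[[]].
  by move=> [[wJ wLs] nw]; split => //; split => // wL; apply: nw.
have mJ := measurable_cyl J; have mJL := measurable_cyl (J ++ L).
have mLs := measurable_cyl_fail Ls.
transitivity (P (cyl J `&` cyl_fail Ls) -
    P ((cyl J `&` cyl_fail Ls) `&` (cyl (J ++ L) `&` cyl_fail Ls)))%E.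
  apply: measureD; [exact: measurableI|exact: measurableI|].
  by rewrite (le_lt_trans (probability_le1 _ _)) ?ltry//; exact: measurableI.
have -> : (cyl J `&` cyl_fail Ls) `&` (cyl (J ++ L) `&` cyl_fail Ls) =
    cyl (J ++ L) `&` cyl_fail Ls.
  by apply/setIidr; rewrite cyl_cat => w [[]].
have uJL : uniq (J ++ L) by move: uJLs; rewrite cat_uniq => /andP[].
have uJLs' : uniq (J ++ flatten Ls).
  move: uJLs; rewrite -catA; apply: subseq_uniq.
  by rewrite cat_subseq // suffix_subseq.
rewrite !IH// (prob_cyl uJL) big_cat/= big_cons.
have [uJ uL] : uniq J /\ uniq L by move: uJL; rewrite cat_uniq => /and3P[].
by rewrite !prob_cyl//= -EFinB; congr EFin; rewrite mulrA mulrBr mulr1 mulrBl.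
Qed.

End Independence.

Section Walks.
Context (R : realType) (d : nat).

Lemma hitting_time_le (wait : nat -> R) (step : nat -> site d) x y m :
  (forall k, 0 < wait k) -> y = x + \sum_(k < m) step k ->
  (hitting_time wait step x y <= (jump_time wait m)%:E)%E.
Proof.
move=> w0 ->; apply: ereal_inf_lbound; exists (jump_time wait m) => //=.
split; first by apply: sumr_ge0 => i _; exact: ltW.
congr (_ + _); rewrite /walk.
have lt_jump : {homo jump_time wait : p q / (p < q)%N >-> p < q}.
  apply: homo_ltn; first exact: lt_trans.
  by move=> n; rewrite /jump_time big_ord_recr /= ltrDl.
have -> : [set n | jump_time wait n.+1 <= jump_time wait m] = `I_m.
  apply/seteqP; split => n /=; rewrite ltnNge; last first.
    by rewrite -ltnNge leq_eqVlt => /orP[/eqP <- //|/lt_jump/ltW].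
  by apply: contraTN => mn; rewrite -ltNge lt_jump.
by rewrite fsbig_ord.
Qed.

Lemma hitting_time_ge0 (wait : nat -> R) (step : nat -> site d) x y :
  (0 <= hitting_time wait step x y)%E.
Proof. by apply: le_ereal_inf_tmp => _ [s [s0 _] <-]; rewrite lee_fin. Qed.

Lemma used_origin (eta : site d -> nat) : used eta 0 0.
Proof. by rewrite /used eqxx leq_max orbT. Qed.

Lemma used_lt (eta : site d -> nat) x j : (j < eta x)%N -> used eta x j.
Proof. by rewrite /used => jx; case: ifP => // _; rewrite leq_max jx. Qed.

Lemma explosion_of_chain (eta : site d -> nat)
    (wait : site d -> nat -> nat -> R) (step : site d -> nat -> nat -> site d)
    (x : nat -> site d) (j : nat -> nat) (t0 : R) :
  injective x ->
  (hitting_time (wait 0%R 0%N) (step 0%R 0%N) 0%R (x 0%N) <= t0%:E)%E ->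
  (forall n, used eta (x n) (j n)) ->
  (forall n, (hitting_time (wait (x n) (j n)) (step (x n) (j n))
     (x n) (x n.+1) <= (2^-1 ^+ n)%:E)%E) ->
  (explosion_time eta wait step < +oo)%E.
Proof.
move=> xinj h0 ux hx.
have t00 : 0 <= t0 by rewrite -lee_fin (le_trans _ h0)// hitting_time_ge0.
apply: (@le_lt_trans _ _ (t0 + 2)%:E); last by rewrite ltry.
apply: ereal_inf_lbound; exists (t0 + 2) => //=; split.
  by rewrite addr_ge0.
have act n : active eta wait step (t0 + 2) (x n, j n).
  split; first exact: ux.
  exists n.+1, (fun i => if i is i'.+1 then x i' else 0).
  exists (fun i => if i is i'.+1 then j i' else 0%N); split => //.
    by case=> [_|i _]; [exact: used_origin|exact: ux].
  rewrite big_ord_recl /= EFinD; apply: leeD => //.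
  apply: (@le_trans _ _ (\sum_(i < n) (2^-1 ^+ i)%:E)%E).
    by apply: lee_sum => i _; exact: hx.
  rewrite sumEFin lee_fin.
  suff -> : \sum_(i < n) 2^-1 ^+ i = 2 - 2 * 2^-1 ^+ n :> R.
    by rewrite gerBl mulr_ge0// exprn_ge0.
  elim: n => [|n IH]; first by rewrite big_ord0 expr0 mulr1 subrr.
  by rewrite big_ord_recr /= IH exprS; lra.
move=> finA; apply: infinite_nat.
rewrite (_ : setT = (fun n => (x n, j n)) @^-1` active eta wait step (t0 + 2)).
  by apply: finite_preimage => // n m _ _ [/xinj].
by apply/seteqP; split => n //= _; exact: act.
Qed.

Definition e1 : site d := \row_(i < d) (val i == 0%N)%:Z.

Lemma l1norm_e1 : (1 <= d)%N -> l1norm e1 = 1%N.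
Proof.
move=> d0; rewrite /l1norm (bigD1 (Ordinal d0)) //= mxE eqxx big1 // => i i0.
by rewrite mxE; case: (val i =P 0%N) => // vi0; case/eqP: i0; exact: val_inj.
Qed.

Lemma e1_inj y : (1 <= d)%N -> injective (fun a => y + e1 *+ a).
Proof.
move=> d0 a b /addrI/matrixP/(_ 0 (Ordinal d0)).
have e1E n : (e1 *+ n) 0 (Ordinal d0) = n%:Z.
  by elim: n => [|n IH]; rewrite ?mulr0n ?mulrSr mxE// IH mxE eqxx -addn1 PoszD.
by rewrite !e1E => -[].
Qed.

Definition speed (n m : nat) : R := 2^-1 ^+ n / m.+1%:R.

Lemma speed_gt0 n m : 0 < speed n m.
Proof. by rewrite divr_gt0// exprn_gt0. Qed.

Lemma hitting_time_fast (wait : nat -> R) (step : nat -> site d) x n m a :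
  (forall k, 0 < wait k) -> (a <= m)%N ->
  (forall k, (k < m)%N -> wait k <= speed n m /\ step k = e1) ->
  (hitting_time wait step x (x + e1 *+ a) <= (2^-1 ^+ n)%:E)%E.
Proof.
move=> w0 am fast; have lt_m (k : 'I_a) : (k < m)%N := leq_trans (ltn_ord k) am.
apply: le_trans (hitting_time_le (m := a) w0 _) _.
  by under eq_bigr => k _ do rewrite (fast k (lt_m k)).2;
     rewrite sumr_const card_ord.
rewrite lee_fin (@le_trans _ _ (\sum_(k < a) speed n m))//.
  by apply: ler_sum => k _; rewrite (fast k (lt_m k)).1.
rewrite sumr_const card_ord /speed -(mulr_natr _ a) mulrAC -mulrA ler_piMr//.
by rewrite ler_pdivrMr// mul1r ler_nat (leq_trans am).
Qed.

Lemma explosion_of_blocks (eta : site d -> nat)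
    (wait : site d -> nat -> nat -> R) (step : site d -> nat -> nat -> site d)
    (y : site d) (m0 K : nat) (b M : nat -> nat) :
  (1 <= d)%N ->
  (forall x j k, 0 < wait x j k) ->
  \sum_(k < m0) step 0 0 k = y ->
  (forall a, (a < b K.+1)%N -> step 0 0%N (m0 + a)%N = e1) ->
  (forall n, (K <= n)%N ->
     exists2 a, (b n <= a < b n.+1)%N & (M n < eta (y + e1 *+ a)%R)%N) ->
  (forall n a, (K <= n)%N -> (b n <= a < b n.+1)%N ->
     exists2 j, (1 <= j <= M n)%N & forall k, (k < b n.+2)%N ->
       wait (y + e1 *+ a) j k <= speed n (b n.+2) /\
       step (y + e1 *+ a) j k = e1) ->
  (explosion_time eta wait step < +oo)%E.
Proof.
move=> d0 w0 my run dense fast.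
have /choice[a /all_and2[ab aM]] : forall n, exists a,
    (b (K + n) <= a < b (K + n).+1)%N /\ (M (K + n) < eta (y + e1 *+ a)%R)%N.
  by move=> n; have [a] := dense _ (leq_addr n K); exists a.
have /choice[j /all_and2[jM fastj]] : forall n, exists j, (1 <= j <= M (K + n))%N
    /\ forall k, (k < b (K + n).+2)%N ->
       wait (y + e1 *+ a n) j k <= speed (K + n) (b (K + n).+2) /\
       step (y + e1 *+ a n) j k = e1.
  by move=> n; have [j] := fast _ _ (leq_addr n K) (ab n); exists j.
have a_lt n : (a n < a n.+1)%N.
  have /andP[_ h] := ab n; have /andP[h' _] := ab n.+1.
  by rewrite (leq_trans h)// -addnS.
have a_inj : injective a.
  apply/incn_inj/leq_mono; apply: homo_ltn => // m n p; exact: ltn_trans.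
apply: (@explosion_of_chain _ _ _ (fun n => y + e1 *+ a n) j
  (jump_time (wait 0 0%N) (m0 + a 0%N))).
- by move=> n m /(e1_inj d0)/a_inj.
- apply: hitting_time_le => //; rewrite add0r big_split_ord /= my.
  have a0 : (a 0%N < b K.+1)%N by have /andP[] := ab 0%N; rewrite addn0.
  under [in RHS]eq_bigr => k _ do rewrite run ?(ltn_trans (ltn_ord k))//.
  by rewrite sumr_const card_ord.
- move=> n; apply/used_lt; apply: leq_ltn_trans (aM n).
  by have /andP[] := jM n.
- move=> n; apply: (@le_trans _ _ (2^-1 ^+ (K + n))%:E); last first.
    rewrite lee_fin exprD ler_piMl ?exprn_ge0// exprn_ile1// invf_le1//.
    by rewrite ler1n.
  have -> : y + e1 *+ a n.+1 = y + e1 *+ a n + e1 *+ (a n.+1 - a n).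
    by rewrite -addrA -mulrnDr subnKC// ltnW.
  apply: (@hitting_time_fast _ _ _ _ (b (K + n).+2)) => //.
    have /andP[_ h] := ab n.+1.
    by rewrite leq_subLR (leq_trans (ltnW h))// addnS leq_addl.
  exact: fastj.
Qed.

End Walks.

Lemma exists_exprn_le (R : realType) (p eps : R) :
  0 < p <= 1 -> 0 < eps -> exists n, (1 - p) ^+ n <= eps.
Proof.
move=> /andP[p0 p1] e0.
have lt1 : `|1 - p| < 1 by rewrite ger0_norm ?subr_ge0// gtrBl.
have /cvgr0Pnorm_le/(_ _ e0)[N _ /(_ N (leqnn N))/= h] := cvg_expr lt1.
by exists N; rewrite (le_trans (ler_norm _)).
Qed.

Section Measure.
Context disp (T : measurableType disp) (R : realType) (P : probability T R).

Lemma probability_bigsetU_le (r : seq nat) (X : nat -> set T) (c : R) :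
  (forall a, measurable (X a)) ->
  (forall a, a \in r -> (P (X a) <= c%:E)%E) ->
  (P (\big[setU/set0]_(a <- r) X a) <= ((size r)%:R * c)%:E)%E.
Proof.
move=> mX; elim: r => [|a r IH] Xc; first by rewrite big_nil measure0 mul0r.
rewrite big_cons (le_trans (measureU2 _ (mX _) _))//.
  exact: bigsetU_measurable.
rewrite /= -addn1 natrD mulrDl mul1r addrC EFinD leeD// ?Xc ?mem_head//.
by apply: IH => b br; apply: Xc; rewrite inE br orbT.
Qed.

Lemma probability_bigcup_half (X : nat -> set T) (c : R) : 0 <= c ->
  (forall n, measurable (X n)) ->
  (forall n, (P (X n) <= (c / (2 ^ n.+1)%:R)%:E)%E) ->
  (P (\bigcup_n X n) <= c%:E)%E.
Proof.
move=> c0 mX Xc; apply: le_trans (epsilon_trick0 xpredT c0).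
apply: (@le_trans _ _ (\sum_(n <oo) P (X n))%E); last exact: lee_nneseries.
by apply: measure_sigma_subadditive => //; exact: bigcupT_measurable.
Qed.

Lemma probability_bigcup_disjoint_le (S : countType) (D : set S)
    (C X : S -> set T) (c : R) : 0 <= c ->
  (forall s, measurable (C s)) -> (forall s, measurable (X s)) ->
  trivIset D C ->
  (forall s, D s -> (P (C s `&` X s) <= c%:E * P (C s))%E) ->
  measurable (\bigcup_(s in D) (C s `&` X s)) /\
  (P (\bigcup_(s in D) (C s `&` X s)) <= c%:E)%E.
Proof.
move=> c0 mC mX tC CX.
pose E n : set S := [set s | D s /\ pickle s = n].
have enum (Y : S -> set T) :
    \bigcup_(s in D) Y s = \bigcup_n \bigcup_(s in E n) Y s.
  apply/seteqP; split => [w [s Ds Yw]|w [n _ [s [Ds _] Yw]]]; last by exists s.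
  by exists (pickle s) => //; exists s.
have E0 n : E n = set0 \/ exists2 s, D s & E n = [set s].
  have [->|/set0P[s [Ds sn]]] := eqVneq (E n) set0; [by left|right].
  exists s => //; apply/seteqP; split => [t [_ tn]|_ ->]; last by [].
  by apply: (pcan_inj (@pickleK S)); rewrite tn.
have mE (Y : S -> set T) n : (forall s, measurable (Y s)) ->
    measurable (\bigcup_(s in E n) Y s).
  by move=> mY; case: (E0 n) => [->|[s _ ->]]; rewrite ?bigcup_set0 ?bigcup_set1.
have mCX s : measurable (C s `&` X s) by exact: measurableI.
split; first by rewrite enum; apply: bigcupT_measurable => n; exact: mE.
apply: (@le_trans _ _
    (\sum_(n <oo) (c%:E * P (\bigcup_(s in E n) C s)))%E).
  apply: (@le_trans _ _
      (\sum_(n <oo) P (\bigcup_(s in E n) (C s `&` X s)))%E).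
    apply: measure_sigma_subadditive => [n||]; [exact: mE| |by rewrite enum].
    by rewrite enum; apply: bigcupT_measurable => n; exact: mE.
  apply: lee_nneseries => // n _; case: (E0 n) => [->|[s Ds ->]].
    by rewrite !bigcup_set0 measure0 mule0.
  by rewrite !bigcup_set1 CX.
rewrite nneseriesZl// -measure_semi_bigcup.
- rewrite -{2}(mule1 c%:E) lee_wpmul2l ?lee_fin// probability_le1//.
  by apply: bigcupT_measurable => n; exact: mE.
- by move=> n; exact: mE.
- apply/trivIsetP => n m _ _ nm; apply/seteqP; split => // w [] /=.
  move=> [s [Ds sn] Cs] [t [Dt tm] Ct]; case/eqP: nm.
  by rewrite -sn -tm (tC s t)//; exists w.
- by apply: bigcupT_measurable => n; exact: mE.
Qed.

Lemma negligible_le_expr (B : set T) :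
  (forall K, exists N : set T, [/\ measurable N, B `<=` N &
     (P N <= (2^-1 ^+ K)%:E)%E]) ->
  P.-negligible B.
Proof.
move=> /choice[N /all_and3[mN BN PN]].
exists (\bigcap_K N K); split; first exact: bigcapT_measurable.
  apply/eqP; rewrite eq_le measure_ge0 andbT.
  apply/lee_addgt0Pr => e e0; rewrite add0e.
  have h1 : 0 < (2^-1 : R) <= 1 by apply/andP; split; lra.
  have [K] := exists_exprn_le h1 e0.
  have -> : 1 - 2^-1 = 2^-1 :> R by lra.
  move=> Ke; apply: (@le_trans _ _ (P (N K))); last first.
    by rewrite (le_trans (PN K)).
  apply: le_measure; rewrite ?inE//; first exact: bigcapT_measurable.
  exact: bigcap_inf.
by move=> w Bw K _; exact: BN.
Qed.

End Measure.

Lemma exists_law (R : realType) (M : nat -> nat) :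
  exists mu : probability nat R, forall n,
    ((poisson_pmf 1 n)%:E <= mu [set k | (M n < k)%N])%E.
Proof.
have mS : measurable_fun [set: nat] (fun n => (M n).+1) by [].
pose X : {mfun nat >-> nat} := mfun_Sub (mem_set mS).
exists (distribution (poisson_prob (1 : R) 0) X) => n.
have -> : (poisson_pmf 1 n)%:E = poisson_prob (1 : R) 0 [set n].
  by rewrite /poisson_prob ltr01 esum_set1// lee_fin poisson_pmf_ge0.
by apply: le_measure; rewrite ?inE// => _ -> /=.
Qed.

Lemma poisson_pmf_itv (R : realType) n : 0 < poisson_pmf (1 : R) n <= 1.
Proof.
apply/andP; split.
  by rewrite /poisson_pmf ltr01 expr1n mul1r mulr_gt0 ?expR_gt0//.
rewrite -lee_fin.
have -> : (poisson_pmf 1 n)%:E = poisson_prob (1 : R) 0 [set n].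
  by rewrite /poisson_prob ltr01 esum_set1// lee_fin poisson_pmf_ge0.
exact: probability_le1.
Qed.

(* The chance that one particle makes its first [m] jumps along [e1], each after
   a waiting time of at most [speed R n m]. *)
Definition fast_prob (R : realType) (d n m : nat) : R :=
  ((1 - expR (- speed R n m)) * (2 * d)%:R^-1) ^+ m.

Lemma fast_prob_itv (R : realType) d n m :
  (1 <= d)%N -> 0 < fast_prob R d n m <= 1.
Proof.
move=> d0; have e1 : expR (- speed R n m) < 1.
  by rewrite expR_lt1 oppr_lt0 speed_gt0.
have d2 : 0 < (2 * d)%:R :> R by rewrite ltr0n muln_gt0.
apply/andP; split; first by rewrite exprn_gt0// mulr_gt0 ?invr_gt0// subr_gt0.
rewrite exprn_ile1//; first by rewrite mulr_ge0 ?invr_ge0 ?subr_ge0// ltW.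
rewrite mulr_ile1 ?invr_ge0 ?subr_ge0 ?(ltW e1) ?(ltW d2)//.
by rewrite invf_le1// ler1n muln_gt0.
Qed.

Definition block_start (w : nat -> nat) n := (\sum_(i < n) w i)%N.

Lemma block_startS w n : block_start w n.+1 = (block_start w n + w n)%N.
Proof. by rewrite /block_start big_ord_recr. Qed.

Lemma exists_scales (R : realType) (d : nat) : (1 <= d)%N ->
  exists w M : nat -> nat, forall n,
    (1 - poisson_pmf (1 : R) n) ^+ w n <= 2^-1 ^+ n / 4 /\
    (w n)%:R * (1 - fast_prob R d n (block_start w n.+2)) ^+ M n
      <= 2^-1 ^+ n / 4.
Proof.
move=> d0; have eps0 n : 0 < 2^-1 ^+ n / 4 :> R.
  by rewrite divr_gt0// exprn_gt0.
have /choice[w wP] n := exists_exprn_le (poisson_pmf_itv R n) (eps0 n).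
have /choice[M MP] n := exists_exprn_le
  (fast_prob_itv R n (block_start w n.+2) d0)
  (divr_gt0 (eps0 n) (ltr0Sn R (w n))).
exists w, M => n; split; first exact: wP.
apply: (@le_trans _ _ ((w n).+1%:R * (2^-1 ^+ n / 4 / (w n).+1%:R))); last first.
  by rewrite mulrC divfK// pnatr_eq0.
have /andP[_ p1] := fast_prob_itv R n (block_start w n.+2) d0.
by rewrite ler_pM// ?exprn_ge0 ?subr_ge0// ler_nat.
Qed.

Section Runs.
Context (d L : nat).
Implicit Type f : nat -> site d.

Definition ends_in_run (s : seq (site d)) : bool :=
  (L <= size s)%N && all (fun k => nth 0 s (size s - L + k) == e1 d) (iota 0 L).

Definition first_run (s : seq (site d)) : bool :=
  ends_in_run s && all (fun m => ~~ ends_in_run (take m s)) (iota 0 (size s)).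

Lemma ends_in_run_mkseq f n :
  reflect ((L <= n)%N /\ forall k, (k < L)%N -> f (n - L + k)%N = e1 d)
          (ends_in_run (mkseq f n)).
Proof.
rewrite /ends_in_run size_mkseq; apply: (iffP andP) => -[Ln].
  move=> /allP h; split=> // k kL; have := h k.
  rewrite mem_iota/= kL nth_mkseq => [/(_ isT)/eqP//|].
  by rewrite -(ltn_add2l (n - L)) subnK in kL.
move=> h; split=> //; apply/allP => k; rewrite mem_iota/= => kL.
rewrite nth_mkseq ?h//.
by rewrite -(ltn_add2l (n - L)) subnK in kL.
Qed.

Lemma take_mkseq f m n : (m <= n)%N -> take m (mkseq f n) = mkseq f m.
Proof. by move=> mn; rewrite /mkseq -map_take take_iota (minn_idPl mn). Qed.

Lemma first_run_mkseq f n :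
  reflect (ends_in_run (mkseq f n) /\
           forall m, (m < n)%N -> ~~ ends_in_run (mkseq f m))
          (first_run (mkseq f n)).
Proof.
rewrite /first_run size_mkseq; apply: (iffP andP) => -[en].
  move=> /allP h; split=> // m mn; rewrite -(take_mkseq f (ltnW mn)).
  by apply: h; rewrite mem_iota.
move=> h; split=> //; apply/allP => m; rewrite mem_iota/= => mn.
by rewrite take_mkseq ?h// ltnW.
Qed.

Lemma first_run_inj f m n :
  first_run (mkseq f m) -> first_run (mkseq f n) -> m = n.
Proof.
move=> /first_run_mkseq[em lm] /first_run_mkseq[en ln].
by case: (ltngtP m n) => // [/ln|/lm]; rewrite ?em ?en.
Qed.

Lemma exists_first_run f i : (forall k, (k < L)%N -> f (i + k)%N = e1 d) ->
  exists n, first_run (mkseq f n).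
Proof.
move=> run; have ex : exists n, ends_in_run (mkseq f n).
  exists (i + L)%N; apply/ends_in_run_mkseq; split; first exact: leq_addl.
  by rewrite addnK.
have [n en ln] := ex_minnP ex; exists n; apply/first_run_mkseq; split=> // m mn.
by apply: contraL mn => /ln; rewrite -leqNgt.
Qed.

End Runs.

Lemma prodr_iota_const (R : pzSemiRingType) (c : R) b n :
  \prod_(a <- iota b n) c = c ^+ n.
Proof. by rewrite big_const_seq count_predT size_iota iter_mulr_1. Qed.

Section Model.
Context (disp : measure_display) (T : measurableType disp) (R : realType).
Context (P : probability T R) (d : nat) (mu : probability nat R).
Context (eta : site d -> {RV P >-> nat}).
Context (wait : site d -> nat -> nat -> {RV P >-> measurableTypeR R}).
Context (step : site d -> nat -> nat -> T -> site d).
Hypothesis d0 : (1 <= d)%N.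
Hypothesis frog : frog_model mu eta wait step.

Local Notation index :=
  (site d + (site d * nat * nat) + (site d * nat * nat))%type.

Lemma wait_positive x j n : P.-negligible [set w | wait x j n w <= 0].
Proof.
have neg0 : P (wait x j n @^-1` `]-oo, 0[) = 0%E.
  rewrite -[LHS]/(distribution P (wait x j n) _) (frog_wait frog)//.
  apply: integral0_eq => r /=; rewrite in_itv/= => r0.
  by rewrite lt0_exponential_pdf.
have zero0 : P (wait x j n @^-1` [set 0]) = 0%E.
  rewrite -[LHS]/(distribution P (wait x j n) _) (frog_wait frog)//.
  exact: integral_set1.
have mw (B : set (measurableTypeR R)) : measurable B ->
    measurable (wait x j n @^-1` B).
  by move=> mB; exact: measurable_funPTI.
have nneg : P.-negligible (wait x j n @^-1` `]-oo, 0[).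
  by apply/negligibleP => //; apply: mw; exact: measurable_itv.
have nzero : P.-negligible (wait x j n @^-1` [set 0]).
  by apply/negligibleP => //; apply: mw; exact: measurable_set1.
apply: negligibleS (negligibleU nneg nzero) => w /=.
by rewrite le_eqVlt in_itv/= => /orP[/eqP|]; [right|left].
Qed.

(* The step constraint of the particle (0, 0) follows [s], padded by [e1]; every
   other particle has to jump along [e1]. *)
Definition frog_event (M : nat) (delta : R) (s : seq (site d)) (i : index)
    : set T :=
  match i with
  | inl (inl x) => eta x @^-1` [set k | (k <= M)%N]
  | inl (inr (x, j, n)) => wait x j n @^-1` `[0, delta]
  | inr (x, j, n) => step x j n @^-1`
      [set if (x, j) == (0, 0%N) then nth (e1 d) s n else e1 d]
  end.

Section Events.
Context (M : nat) (delta : R) (s : seq (site d)).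
Local Notation evt := (frog_event M delta s).

Lemma frog_event_sigma i : frog_sigma_algebra eta wait step i (evt i).
Proof.
case: i => [[x|[[x j] n]]|[[x j] n]] /=.
- by exists [set k | (k <= M)%N] => //; rewrite setTI.
- by exists `[0, delta]%classic; rewrite ?setTI//; exact: measurable_itv.
- by eexists; [|rewrite setTI; reflexivity].
Qed.

Lemma measurable_frog_event i : measurable (evt i).
Proof.
case: i => [[x|[[x j] n]]|[[x j] n]] /=.
- exact: measurable_funPTI.
- by apply: measurable_funPTI; exact: measurable_itv.
- exact: (frog_step_measurable frog).
Qed.

Lemma prob_frog_wait x j n : 0 < delta ->
  P (evt (inl (inr (x, j, n)))) = (1 - expR (- delta))%:E.
Proof.
move=> del0 /=; rewrite -[LHS]/(distribution P (wait x j n) _).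
rewrite (frog_wait frog); last exact: measurable_itv.
by rewrite exponential_prob_itv0c// mulN1r EFinB.
Qed.

Lemma prob_frog_step x j n : (x, j) != (0, 0%N) \/ (size s <= n)%N ->
  P (evt (inr (x, j, n))) = ((2 * d)%:R^-1)%:E.
Proof.
move=> h; have -> : evt (inr (x, j, n)) = step x j n @^-1` [set e1 d].
  rewrite /frog_event; case: ifPn => // xj.
  by case: h => [|sn]; [rewrite xj|rewrite nth_default].
by rewrite (frog_step frog)// l1norm_e1.
Qed.

Definition path_idx : seq index :=
  [seq inr ((0, 0%N), k) | k <- iota 0 (size s)].

Definition block_idx (y : site d) (b n : nat) : seq index :=
  [seq inl (inl (y + e1 d *+ a)) | a <- iota b n].

Definition fast_idx (x : site d) (m j : nat) : seq index :=
  [seq inl (inr ((x, j), k)) | k <- iota 0 m] ++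
  [seq inr ((x, j), k) | k <- iota 0 m].

Lemma uniq_path_idx : uniq path_idx.
Proof. by rewrite map_inj_uniq ?iota_uniq// => a b []. Qed.

Lemma uniq_path_block_idx y b n : uniq (path_idx ++ block_idx y b n).
Proof.
rewrite cat_uniq uniq_path_idx/= map_inj_uniq ?iota_uniq ?andbT.
  by apply/hasPn => i /mapP[a _ ->]; apply/mapP => -[].
by move=> a c [] /e1_inj; exact.
Qed.

Lemma uniq_fast_idx x m j : uniq (fast_idx x m j).
Proof.
rewrite cat_uniq !map_inj_uniq ?iota_uniq ?andbT; try by move=> a b [].
by apply/hasPn => i /mapP[a _ ->]; apply/mapP => -[].
Qed.

Lemma uniq_path_fast_idx x m n :
  uniq (path_idx ++ flatten [seq fast_idx x m j | j <- iota 1 n]).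
Proof.
pose f j := if j is 0%N then path_idx else fast_idx x m j.
have -> : path_idx ++ flatten [seq fast_idx x m j | j <- iota 1 n] =
    flatten (map f (iota 0 n.+1)).
  rewrite /=; congr (_ ++ flatten _); apply/eq_in_map => -[|j]//.
  by rewrite mem_iota.
pose g (i : index) : nat :=
  match i with inl (inr (_, j, _)) | inr (_, j, _) => j | _ => 0 end.
apply: (uniq_flatten_tagged (g := g)); first exact: iota_uniq.
  by case=> [|j]; [exact: uniq_path_idx|exact: uniq_fast_idx].
case=> [|j] i /=; first by case/mapP => k _ ->.
by rewrite mem_cat => /orP[] /mapP[k _ ->].
Qed.

Lemma cyl_path_idx :
  cyl evt path_idx = [set w | mkseq (fun k => step 0 0%N k w) (size s) = s].
Proof.
apply/seteqP; split => [w ws|w ws i /= /mapP[k]].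
  apply: (@eq_from_nth _ (e1 d)); rewrite ?size_mkseq// => k ks.
  rewrite nth_mkseq//; have := ws (inr ((0, 0%N), k)) => /=; rewrite eqxx.
  by apply; apply/mapP; exists k; rewrite ?mem_iota.
rewrite mem_iota /= => ks -> /=; rewrite eqxx.
by rewrite -ws nth_mkseq.
Qed.

Let ind := frog_independent frog.
Let inF := frog_event_sigma.
Let mF := measurable_frog_event.

Lemma prob_path_sparse y b n q :
  (forall x, (P (evt (inl (inl x))) <= (1 - q)%:E)%E) ->
  (P (cyl evt path_idx `&` cyl evt (block_idx y b n)) <=
   ((1 - q) ^+ n)%:E * P (cyl evt path_idx))%E.
Proof.
move=> hq; rewrite -cyl_cat !(prob_cyl ind inF) ?uniq_path_idx//; last first.
  exact: uniq_path_block_idx.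
rewrite big_cat /= mulrC -EFinM lee_fin ler_wpM2r//.
  by apply: prodr_ge0 => i _; exact: fine_ge0.
rewrite big_map -(prodr_iota_const _ b).
apply: ler_prod => a _; rewrite fine_ge0//= -lee_fin fineK ?hq//.
by apply: fin_num_measure; exact: (mF (inl (inl _))).
Qed.

Lemma prob_path_slow x m n : 0 < delta ->
  P (cyl evt path_idx `&`
     cyl_fail evt [seq fast_idx x m j | j <- iota 1 n]) =
  (((1 - ((1 - expR (- delta)) * (2 * d)%:R^-1) ^+ m) ^+ n)%:E *
   P (cyl evt path_idx))%E.
Proof.
move=> del0; rewrite (prob_cyl_fail ind inF mF) ?uniq_path_fast_idx//.
rewrite muleC EFinM fineK ?fin_num_measure//; last exact: measurable_cyl.
congr (_ * _%:E)%E; rewrite big_map -(prodr_iota_const _ 1).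
rewrite !big_seq; apply: eq_bigr => j; rewrite mem_iota => /andP[j1 _].
congr (1 - _); rewrite (prob_cyl ind inF) ?uniq_fast_idx//.
rewrite /= big_cat !big_map /= exprMn -!(prodr_iota_const _ 0).
congr (_ * _); apply: eq_bigr => k _; first by rewrite prob_frog_wait.
rewrite prob_frog_step//; left.
by rewrite xpair_eqE negb_and -[X in _ || X]lt0n j1 orbT.
Qed.

End Events.
Lemma no_run_negligible L : P.-negligible
  [set w | forall i, exists2 k, (k < L)%N & step 0 0%N (i + k)%N w <> e1 d].
Proof.
apply: negligible_le_expr => K.
pose evt := frog_event 0 0 [::].
pose window i : seq index := [seq inr ((0, 0%N), (i * L + k)%N) | k <- iota 0 L].
pose N n := cyl_fail evt [seq window i | i <- iota 0 n].
have mF := measurable_frog_event 0 0 [::].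
have p01 : 0 < ((2 * d)%:R^-1 : R) ^+ L <= 1.
  have d2 : (0 < 2 * d)%N by rewrite muln_gt0.
  rewrite exprn_gt0 ?invr_gt0 ?ltr0n//= exprn_ile1 ?invr_ge0//.
  by rewrite invf_le1 ?ltr0n// ler1n.
have [n Kn] : exists n, (1 - ((2 * d)%:R^-1 : R) ^+ L) ^+ n <= 2^-1 ^+ K.
  by apply: exists_exprn_le => //; rewrite exprn_gt0.
have uniq_window i : uniq (window i).
  by rewrite map_inj_uniq ?iota_uniq// => a c [] /addnI.
exists (N n); split; first exact: measurable_cyl_fail.
  move=> w norun J /= /mapP[i _ ->] run.
  have [k kL] := norun (i * L)%N; apply.
  have /= := run (inr ((0, 0%N), (i * L + k)%N)); rewrite eqxx nth_nil.
  by apply; apply/mapP; exists k; rewrite ?mem_iota.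
have -> : N n = cyl evt [::] `&` N n.
  by apply/esym/setIidr => w _ i.
rewrite (prob_cyl_fail (frog_independent frog) (frog_event_sigma 0 0 [::]) mF)/=.
  rewrite (prob_cyl (frog_independent frog) (frog_event_sigma 0 0 [::]))//.
  rewrite big_nil mul1r big_map lee_fin.
  apply: le_trans Kn; rewrite -(prodr_iota_const _ 0).
  rewrite (eq_bigr (fun=> 1 - ((2 * d)%:R^-1 : R) ^+ L))// => i _; congr (1 - _).
  rewrite (prob_cyl (frog_independent frog) (frog_event_sigma 0 0 [::]))//=.
  rewrite big_map -(prodr_iota_const _ 0); apply: eq_bigr => k _.
  by rewrite prob_frog_step//; right.
apply: (uniq_flatten_tagged
  (g := fun i : index => if i is inr (_, k) then (k %/ L)%N else 0%N)) => //.
  exact: iota_uniq.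
move=> i _ /mapP[k + ->]; rewrite mem_iota/= => kL.
by rewrite divnMDl ?divn_small ?addn0// (leq_ltn_trans _ kL).
Qed.

Section Scales.
Context (width M : nat -> nat).
Local Notation b := (block_start width).
Hypothesis widthP : forall n,
  (1 - poisson_pmf (1 : R) n) ^+ width n <= 2^-1 ^+ n / 4.
Hypothesis MP : forall n,
  (width n)%:R * (1 - fast_prob R d n (b n.+2)) ^+ M n <= 2^-1 ^+ n / 4.
Hypothesis muP : forall n,
  ((poisson_pmf 1 n)%:E <= mu [set k | (M n < k)%N])%E.

Local Notation evt n s := (frog_event (M n) (speed R n (b n.+2)) s).

Definition path_event (s : seq (site d)) : set T :=
  [set w | mkseq (fun k => step 0 0%N k w) (size s) = s].

Definition sparse n s y : set T :=
  cyl (evt n s) (block_idx y (b n) (width n)).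

Definition slow n s y : set T :=
  \big[setU/set0]_(a <- iota (b n) (width n))
    cyl_fail (evt n s)
      [seq fast_idx (y + e1 d *+ a) (b n.+2) j | j <- iota 1 (M n)].

Lemma measurable_path_event s : measurable (path_event s).
Proof.
by rewrite /path_event -(cyl_path_idx 0 0 s); apply: measurable_cyl => i;
   exact: measurable_frog_event.
Qed.

Lemma measurable_sparse n s y : measurable (sparse n s y).
Proof. by apply: measurable_cyl => i; exact: measurable_frog_event. Qed.

Lemma measurable_slow n s y : measurable (slow n s y).
Proof.
apply: bigsetU_measurable => a _; apply: measurable_cyl_fail => i.
exact: measurable_frog_event.
Qed.

Lemma prob_eta_le n s x :
  (P (evt n s (inl (inl x))) <= (1 - poisson_pmf 1 n)%:E)%E.
Proof.
rewrite [leLHS](_ : _ = mu (~` [set k | (M n < k)%N])).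
  rewrite probability_setC// EFinB leeB//.
rewrite -(frog_eta frog x); congr (P _).
by apply/seteqP; split => w /=; [move/leq_gtF->|move/negP; rewrite -leqNgt].
Qed.

Lemma prob_bad_level n s y :
  (P (path_event s `&` (sparse n s y `|` slow n s y)) <=
   (2^-1 ^+ n / 2)%:E * P (path_event s))%E.
Proof.
have mp := measurable_path_event s.
rewrite setIUr (_ : 2^-1 ^+ n / 2 = 2^-1 ^+ n / 4 + 2^-1 ^+ n / 4); last by lra.
apply: le_trans (measureU2 P (measurableI _ _ mp (measurable_sparse n s y))
  (measurableI _ _ mp (measurable_slow n s y))) _.
rewrite EFinD ge0_muleDl ?lee_fin ?divr_ge0 ?exprn_ge0// leeD//.
  rewrite /path_event -(cyl_path_idx (M n) (speed R n (b n.+2)) s).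
  apply: le_trans (prob_path_sparse _ _ _ (prob_eta_le n s)) _.
  by rewrite lee_wpmul2r// lee_fin.
rewrite -(@fineK _ (P (path_event s))) ?fin_num_measure//.
apply: (@le_trans _ _ ((size (iota (b n) (width n)))%:R *
    ((1 - fast_prob R d n (b n.+2)) ^+ M n * fine (P (path_event s))))%:E).
  rewrite /slow big_distrr/=.
  apply: probability_bigsetU_le => a.
    apply: measurableI => //; apply: measurable_cyl_fail => i.
    exact: measurable_frog_event.
  rewrite EFinM fineK ?fin_num_measure//.
  rewrite /path_event -(cyl_path_idx (M n) (speed R n (b n.+2)) s).
  by move=> _; rewrite prob_path_slow ?speed_gt0.
by rewrite size_iota mulrA -EFinM lee_fin ler_wpM2r// fine_ge0.
Qed.

Definition run_start K (s : seq (site d)) : site d :=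
  \sum_(k < size s - b K.+1) nth 0 s k.

Definition bad K s : set T :=
  \bigcup_n (sparse (K + n) s (run_start K s) `|`
             slow (K + n) s (run_start K s)).

Lemma measurable_bad K s : measurable (bad K s).
Proof.
apply: bigcupT_measurable => n.
by apply: measurableU; [exact: measurable_sparse|exact: measurable_slow].
Qed.

Lemma prob_bad K s :
  (P (path_event s `&` bad K s) <= (2^-1 ^+ K)%:E * P (path_event s))%E.
Proof.
have mp := measurable_path_event s.
rewrite -(@fineK _ (P (path_event s))) ?fin_num_measure// -EFinM /bad setI_bigcupr.
apply: probability_bigcup_half => [|n|n].
- by rewrite mulr_ge0 ?exprn_ge0// fine_ge0.
- apply: measurableI => //.
  by apply: measurableU; [exact: measurable_sparse|exact: measurable_slow].
apply: le_trans (prob_bad_level _ _ _) _.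
rewrite -(@fineK _ (P (path_event s))) ?fin_num_measure// -EFinM lee_fin.
by rewrite natrX exprD -exprVn exprS; lra.
Qed.

Definition escape K : set T :=
  \bigcup_(s in [set s | first_run (b K.+1) s]) (path_event s `&` bad K s).

Lemma prob_escape K :
  measurable (escape K) /\ (P (escape K) <= (2^-1 ^+ K)%:E)%E.
Proof.
apply: probability_bigcup_disjoint_le => [|s|s||s _].
- by rewrite exprn_ge0.
- exact: measurable_path_event.
- exact: measurable_bad.
- move=> s t /= fs ft [w [ws wt]]; move: fs ft; rewrite -ws -wt => fs ft.
  by rewrite (first_run_inj fs ft).
- exact: prob_bad.
Qed.

Lemma explosion_of_not_escape w K i :
  (forall x j n, 0 < wait x j n w) ->
  (forall k, (k < b K.+1)%N -> step 0 0%N (i + k)%N w = e1 d) ->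
  ~ escape K w ->
  (explosion_time (fun x => eta x w) (fun x j n => wait x j n w)
     (fun x j n => step x j n w) < +oo)%E.
Proof.
move=> w0 steps nesc; pose f k := step 0 0%N k w.
have [m run] := @exists_first_run _ _ f _ steps.
pose s := mkseq f m; rewrite -/s in run.
have ms : size s = m by rewrite size_mkseq.
have nbad : ~ bad K s w.
  by move=> wbad; apply: nesc; exists s => //; split=> //; rewrite /path_event/= ms.
have /first_run_mkseq[/ends_in_run_mkseq[Lm endrun] _] := run.
have in_block n a : (b n <= a < b n.+1)%N -> a \in iota (b n) (width n).
  by rewrite mem_iota -block_startS.
apply: (@explosion_of_blocks _ _ _ _ _ (run_start K s) (m - b K.+1) K b M) => //.
- rewrite /run_start ms; apply: eq_bigr => k _.
  by rewrite nth_mkseq// (leq_trans (ltn_ord k))// leq_subr.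
- move=> n Kn; apply: contrapT => none; apply: nbad.
  exists (n - K)%N => //; left; rewrite subnKC//.
  move=> _ /= /mapP[a + ->]; rewrite mem_iota -block_startS /= => ab.
  rewrite leqNgt; apply/negP => aM.
  by apply: none; exists a.
- move=> n a Kn ab; apply: contrapT => none; apply: nbad.
  exists (n - K)%N => //; right; rewrite subnKC//.
  rewrite /slow -bigcup_seq; exists a; first exact: in_block.
  move=> _ /= /mapP[j + ->]; rewrite mem_iota add1n ltnS => jM fast.
  apply: none; exists j => // k km.
  have ik : k \in iota 0 (b n.+2) by rewrite mem_iota.
  split.
    have := fast (inl (inr (run_start K s + e1 d *+ a, j, k))).
    rewrite /= mem_cat map_f// => /(_ isT).
    by rewrite in_itv/= => /andP[].
  have := fast (inr (run_start K s + e1 d *+ a, j, k)).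
  rewrite /= mem_cat (map_f _ ik) orbT => /(_ isT).
  have j0 : (j == 0%N) = false by case/andP: jM; case: (j).
  by rewrite xpair_eqE j0 andbF.
Qed.

Lemma explosion_ae : {ae P, forall w,
  (explosion_time (fun x => eta x w) (fun x j n => wait x j n w)
     (fun x j n => step x j n w) < +oo)%E}.
Proof.
pose waits := \bigcup_p if @unpickle (site d * nat * nat)%type p is Some (x, j, n)
  then [set w | wait x j n w <= 0] else set0.
pose norun := \bigcup_K [set w | forall i, exists2 k,
  (k < b K.+1)%N & step 0 0%N (i + k)%N w <> e1 d].
have neg_waits : P.-negligible waits.
  apply: negligible_bigcup => p; case: unpickle => [[[x j] n]|].
    exact: wait_positive.
  exact: negligible_set0.
have neg_norun : P.-negligible norun.
  by apply: negligible_bigcup => K; exact: no_run_negligible.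
have neg_escape : P.-negligible (\bigcap_K escape K).
  apply: negligible_le_expr => K; exists (escape K).
  by have [mE PE] := prob_escape K; split => //; exact: bigcap_inf.
apply: negligibleS (negligibleU (negligibleU neg_waits neg_norun) neg_escape).
move=> w /= noexp; apply: contrapT => /not_orP[/not_orP[nwaits nnorun] nesc].
apply: noexp.
have [K nK] : exists K, ~ escape K w.
  by apply/existsNP => h; apply: nesc => K _; exact: h.
have [i run] : exists i, forall k, (k < b K.+1)%N ->
    step 0 0%N (i + k)%N w = e1 d.
  apply: contrapT => none; apply: nnorun; exists K => // i.
  apply: contrapT => h; apply: none; exists i => k kb.
  by apply: contrapT => sk; apply: h; exists k.
apply: explosion_of_not_escape run nK => x j n.
rewrite ltNge; apply/negP => w0; apply: nwaits.
by exists (pickle (x, j, n)) => //; rewrite pickleK.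
Qed.

End Scales.
End Model.

Theorem theorem1p1 (R : realType) (d : nat) (hd : (1 <= d)%N) :
  exists mu : probability nat R,
    forall (disp : measure_display) (T : measurableType disp)
      (P : probability T R)
      (eta : site d -> {RV P >-> nat})
      (wait : site d -> nat -> nat -> {RV P >-> measurableTypeR R})
      (step : site d -> nat -> nat -> T -> site d),
      frog_model mu eta wait step ->
      {ae P, forall w : T,
        (explosion_time (fun x => eta x w) (fun x j n => wait x j n w)
           (fun x j n => step x j n w) < +oo)%E}.
Proof.
have [width [M scales]] := exists_scales R hd.
have [mu muP] := exists_law R M.
exists mu => disp T P eta wait step frog.
exact: (explosion_ae hd frog (fun n => (scales n).1) (fun n => (scales n).2) muP).
Qed.
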